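(* Let $d\ge 1$ and let $\{A^{ij}\}_{i,j=0}^{d-1}$ and $\{B^{ij}\}_{i,j=0}^{d-1}$ be two normal SIMPS tensors (with the same physical dimension $d$) that generate the same state for all system sizes, i.e. for every $N\ge 1$ and all $i_1,\dots,i_N\in\{0,\dots,d-1\}$, $$\mathrm{Tr}(A^{i_1i_2}A^{i_2i_3}\cdots A^{i_Ni_1})=\mathrm{Tr}(B^{i_1i_2}B^{i_2i_3}\cdots B^{i_Ni_1}).$$ Then there is a set of invertible matrices $V_i$, $i=0,\dots,d-1$, such that $$A^{ij}=V_i\,B^{ij}\,V_j^{-1}\qquad\text{for all } i,j\in\{0,\dots,d-1\}.$$ (In particular the matrix dimensions of $A^{ij}$ and $B^{ij}$ agree.)
   Context: A SIMPS (split-index matrix product state) tensor with physical dimension $d$ is a family of complex matrices $B^{ij}$, $i,j\in\{0,\dots,d-1\}$, where $B^{ij}$ is a $\chi^i\times\chi^j$ matrix for some integers $\chi^0,\dots,\chi^{d-1}$. For each $N$ it generates the (unnormalized) state of $N$ spins of dimension $d$ on a ring $$|\psi\rangle=\sum_{i_1,\dots,i_N}\mathrm{Tr}(B^{i_1i_2}B^{i_2i_3}\cdots B^{i_Ni_1})\,|i_1i_2\cdots i_N\rangle .$$ A SIMPS tensor $B^{ij}$ is normal if there is a finite positive integer $L_1$ such that for all $s_1,s_2\in\{0,\dots,d-1\}$, $$\mathrm{span}\{B^{s_1i_1}B^{i_1i_2}\cdots B^{i_{L_1-1}i_{L_1}}B^{i_{L_1}s_2}\}_{i_1,\dots,i_{L_1}}=M_{\chi^{s_1},\chi^{s_2}},$$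 where $M_{\chi^{s_1},\chi^{s_2}}$ is the space of all complex $\chi^{s_1}\times\chi^{s_2}$ matrices. *)

(* Defs.v *)
From mathcomp Require Import all_boot all_order all_algebra.
From mathcomp Require Import reals.
From mathcomp Require Export complex.

Set Implicit Arguments.
Unset Strict Implicit.
Unset Printing Implicit Defensive.

Import GRing.Theory.

Local Open Scope ring_scope.

Section Simps.

Variables (R : realType) (d : nat).

Definition simps (chi : 'I_d -> nat) : Type :=
  forall i j : 'I_d, 'M[R[i]]_(chi i, chi j).

Variables (chi : 'I_d -> nat) (B : simps chi).

(* For s = [:: k_1; ...; k_n] this is B^{i k_1} B^{k_1 k_2} ... B^{k_n j},
   a product of n + 1 matrices. *)
Fixpoint simps_prod (i : 'I_d) (s : seq 'I_d) (j : 'I_d) :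
    'M[R[i]]_(chi i, chi j) :=
  if s is k :: s' then B i k *m simps_prod k s' j else B i j.

(* The vector of coefficients in the basis |i_1 ... i_N>. The value at
   N = 0 is a placeholder: a ring has at least one site. *)
Definition simps_state (N : nat) : {ffun N.-tuple 'I_d -> R[i]} :=
  [ffun t : N.-tuple 'I_d =>
     (if tval t is i :: s then \tr (simps_prod i s i) else 0) : R[i]].

Definition simps_normal : Prop :=
  exists L : nat, (0 < L)%N /\
    forall s1 s2 : 'I_d,
      (<< [seq simps_prod s1 t s2 | t : L.-tuple 'I_d] >>
         = {: 'M[R[i]]_(chi s1, chi s2)})%VS.

End Simps.

(* Main.v *)
(* The two tensors satisfy the same linear relations between words: a
   combination of A-words from i to j vanishes iff all its traces against
   A-words from j to i vanish, and these traces are the same for B.  Hence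
   A_w |-> B_w extends to injective linear maps phi_ij from
   M_(chiA i, chiA j) to M_(chiB i, chiB j) with phi (X Y) = phi X * phi Y.
   As in the usual proof of the Skolem-Noether theorem, fixing a site i0, a
   row vector r and a column vector v, the maps T_i : x |-> phi (x r) v
   satisfy phi X * T_j = T_i X, and for suitable r and v they are injective.
   Exchanging A and B, the dimensions agree, so each T_i is invertible. *)
Require Import Defs.
From HB Require Import structures.
From mathcomp Require Import all_boot all_order all_algebra.
From mathcomp Require Import reals.

Set Implicit Arguments.
Unset Strict Implicit.
Unset Printing Implicit Defensive.

Import GRing.Theory.

Local Open Scope ring_scope.

(** Testing against the matrix unit [delta_mx b a] reads off the entry [Y a b]. *)
Lemma mxtrace_mul_nondegenerate (K : pzRingType) m n (Y : 'M[K]_(m, n)) :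
  (forall Z : 'M_(n, m), \tr (Y *m Z) = 0) -> Y = 0.
Proof.
move=> Y0; apply/matrixP => a b; rewrite mxE -(Y0 (delta_mx b a)) /mxtrace.
rewrite (bigD1 a) //= big1 ?addr0 => [|c /negbTE ca].
  rewrite mxE (bigD1 b) //= big1 ?addr0 => [|k /negbTE kb].
    by rewrite mxE !eqxx mulr1.
  by rewrite mxE kb mulr0.
by rewrite mxE big1 // => k _; rewrite mxE ca andbF mulr0.
Qed.

Lemma castmx_mull (K : pzRingType) m m' n n' p (em : m = m') (en : n = n')
    (M : 'M[K]_(m, n)) (N : 'M[K]_(n, p)) :
  castmx (em, en) M *m castmx (en, erefl p) N = castmx (em, erefl p) (M *m N).
Proof. by case: m' / em; case: n' / en; rewrite !castmx_id. Qed.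

Lemma castmx_mulr (K : pzRingType) m m' n p (em : m = m')
    (M : 'M[K]_(m, n)) (N : 'M[K]_(n, p)) :
  castmx (em, erefl n) M *m N = castmx (em, erefl p) (M *m N).
Proof. by case: m' / em; rewrite !castmx_id. Qed.

Lemma castmx_unit (K : fieldType) m n (e : m = n) (M : 'M[K]_(m, n)) :
  \rank M = n -> castmx (e, erefl n) M \in unitmx.
Proof.
by case: n / e M => M rM; rewrite castmx_id -row_full_unit; apply/eqP.
Qed.

Section Words.

Variables (R : realType) (d : nat) (chi : 'I_d -> nat) (B : simps R chi).

Lemma simps_prod_cat i s k t j :
  simps_prod B i (s ++ k :: t) j = simps_prod B i s k *m simps_prod B k t j.
Proof. by elim: s i => [|l s IHs] i //=; rewrite IHs mulmxA. Qed.

(** Words of one fixed length already span, so a property stable under linear combinations need only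
    be checked on words. Asking it for words of every length hides that length from later proofs. *)
Lemma normal_word_ind i j (P : 'M[R[i]]_(chi i, chi j) -> Prop) :
  simps_normal B -> P 0 -> (forall a X Y, P X -> P Y -> P (a *: X + Y)) ->
  (forall u, P (simps_prod B i u j)) -> forall X, P X.
Proof.
move=> [L [_ spanB]] P0 Plin Pword X.
have: X \in <<codom_tuple (fun t : L.-tuple 'I_d => simps_prod B i t j)>>%VS.
  by rewrite (spanB i j) memvf.
move=> /coord_span ->.
elim/big_rec: _ => // k Y _ PY; apply: Plin => //.
by rewrite nth_codom.
Qed.

Lemma normal_nondegenerate i j (Y : 'M[R[i]]_(chi i, chi j)) :
  simps_normal B -> (forall u, \tr (Y *m simps_prod B j u i) = 0) -> Y = 0.
Proof.
move=> nB Y0; apply: mxtrace_mul_nondegenerate.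
apply: (normal_word_ind nB) => // [|a X Z XY0 ZY0]; first by rewrite mulmx0 linear0.
by rewrite mulmxDr -scalemxAr linearP /= XY0 ZY0 mulr0 addr0.
Qed.

End Words.

Section Intertwiner.

Variables (R : realType) (d : nat) (chiA chiB : 'I_d -> nat).
Variables (A : simps R chiA) (B : simps R chiB).
Hypotheses (normalA : simps_normal A) (normalB : simps_normal B).
Hypothesis same_state : forall N : nat, (1 <= N)%N ->
  simps_state A N = simps_state B N.

Lemma mxtrace_loop i s :
  \tr (simps_prod A i s i) = \tr (simps_prod B i s i).
Proof.
have /ffunP/(_ (in_tuple (i :: s))) := same_state (ltn0Sn (size s)).
by rewrite !ffunE.
Qed.

Lemma mxtrace_words i j w u :
  \tr (simps_prod A i w j *m simps_prod A j u i) =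
  \tr (simps_prod B i w j *m simps_prod B j u i).
Proof. by rewrite -!simps_prod_cat mxtrace_loop. Qed.

(** The spanning words may be linearly dependent, so [coord] makes an arbitrary choice of
    coefficients. The trace identity holds for any choice, because [mxtrace_words] compares the
    words one by one. *)
Lemma word_map_exists : exists phi : forall i j,
    {linear 'M[R[i]]_(chiA i, chiA j) -> 'M[R[i]]_(chiB i, chiB j)},
  forall i j X u,
    \tr (phi i j X *m simps_prod B j u i) = \tr (X *m simps_prod A j u i).
Proof.
have [L [_ spanA]] := normalA.
pose words i j := codom_tuple (fun t : L.-tuple 'I_d => simps_prod A i t j).
pose f i j (X : 'M[R[i]]_(chiA i, chiA j)) :=
  \sum_k coord (words i j) k X *: simps_prod B i (enum_val k) j.
have f_lin i j : linear (@f i j).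
  move=> a X Y; rewrite /f scaler_sumr -big_split; apply: eq_bigr => k _ /=.
  by rewrite linearP scalerDl scalerA.
pose fL i j := GRing.isLinear.Build _ _ _ _ (@f i j) (f_lin i j).
pose phi i j : {linear _ -> _} := HB.pack (@f i j) (fL i j).
exists phi => i j X u.
have /coord_span {2}-> : X \in <<words i j>>%VS by rewrite (spanA i j) memvf.
rewrite /= /f !mulmx_suml !linear_sum; apply: eq_bigr => k _ /=.
by rewrite nth_codom -!scalemxAl !mxtraceZ mxtrace_words.
Qed.

Lemma intertwiner_exists : exists T : forall i, 'M[R[i]]_(chiB i, chiA i),
  (forall i, \rank (T i) = chiA i) /\
  (forall i j, B i j *m T j = T i *m A i j).
Proof.
(* If all the spaces of A are zero, there is no basis vector to build [r] from, but zero matrices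
   have the required rank. *)
have [chi0|] := altP (@forallP _ (fun i => chiA i == 0%N)).
  exists (fun=> 0); split=> [i|i j]; last by rewrite mulmx0 mul0mx.
  by rewrite mxrank0 (eqP (chi0 i)).
rewrite negb_forall => /existsP[i0]; rewrite -lt0n => chi_gt0.
have [phi phiE] := word_map_exists.
have phi_uniq i j X Y :
    (forall u, \tr (Y *m simps_prod B j u i) = \tr (X *m simps_prod A j u i)) ->
    phi i j X = Y.
  move=> XY; apply/eqP; rewrite -subr_eq0; apply/eqP.
  apply: (normal_nondegenerate normalB) => u.
  by rewrite mulmxBl linearB /= phiE XY subrr.
have phi_word i j w : phi i j (simps_prod A i w j) = simps_prod B i w j.
  by apply: phi_uniq => u; rewrite mxtrace_words.
have phi_inj i j X : phi i j X = 0 -> X = 0.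
  move=> X0; apply: (normal_nondegenerate normalA) => u.
  by rewrite -phiE X0 mul0mx linear0.
have phi_mul_word i j k X u :
    phi i k (X *m simps_prod A j u k) = phi i j X *m simps_prod B j u k.
  by apply: phi_uniq => v; rewrite -!mulmxA -!simps_prod_cat phiE.
have phi_tr i j X Y : \tr (phi i j X *m phi j i Y) = \tr (X *m Y).
  move: Y; apply: (normal_word_ind normalA) => [|a Y Z XY XZ|u].
  - by rewrite linear0 !mulmx0 !linear0.
  - by rewrite linearP !mulmxDr -!scalemxAr !linearP /= XY XZ.
  by rewrite phi_word phiE.
(* Against a word u, the trace of phi X * phi Y * B_u is that of phi X * phi (Y A_u), hence that of
   X Y A_u. *)
have phiM i j k X Y : phi i k (X *m Y) = phi i j X *m phi j k Y.
  by apply: phi_uniq => u; rewrite -!mulmxA -phi_mul_word phi_tr.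
pose k0 := Ordinal chi_gt0.
pose r : 'rV[R[i]]_(chiA i0) := delta_mx 0 k0.
have [v v_neq0] : exists v, phi i0 i0 (delta_mx k0 k0) *m v != 0 :> 'cV_(chiB i0).
  have: phi i0 i0 (delta_mx k0 k0) != 0.
    apply/eqP => /phi_inj/matrixP/(_ k0 k0)/eqP.
    by rewrite !mxE !eqxx oner_eq0.
  case/matrix0Pn => a [b ab_neq0].
  exists (delta_mx b 0); rewrite -colE; apply/matrix0Pn.
  by exists a, 0; rewrite mxE.
pose T i := \matrix_(a, k) (phi i i0 (delta_mx k 0 *m r) *m v) a 0.
have T_mul i (x : 'cV_(chiA i)) : T i *m x = phi i i0 (x *m r) *m v.
  have {2}-> : x = \sum_k x k 0 *: delta_mx k 0.
    by rewrite {1}[x]matrix_sum_delta; apply: eq_bigr => k _; rewrite big_ord1.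
  apply/colP => a; rewrite mulmx_suml linear_sum mulmx_suml mxE summxE.
  apply: eq_bigr => k _.
  by rewrite -scalemxAl linearZ -scalemxAl [RHS]mxE mulrC mxE.
exists T; split=> [i|i j].
  rewrite -mxrank_tr; apply/eqP; apply: inj_row_free => x Tx0.
  apply/rowP => k; rewrite mxE; apply/eqP; apply: contraNT v_neq0 => xk_neq0.
  have {}Tx0 : T i *m x^T = 0 by rewrite -[T i]trmxK -trmx_mul Tx0 trmx0.
  (* A nonzero entry of x lets [delta_mx k0 k0] factor through [x^T *m r], so T x = 0 would force
     phi ([delta_mx k0 k0]) v = 0, against the choice of v. *)
  have -> : delta_mx k0 k0 = ((x 0 k)^-1 *: delta_mx k0 k) *m (x^T *m r).
    have xk : row k x^T = (x 0 k)%:M by apply/rowP => l; rewrite !ord1 !mxE mulr1n.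
    rewrite -(mul_delta_mx (0 : 'I_1) k0 k) -scalemxAl -mulmxA (mulmxA _ x^T) -rowE xk.
    by rewrite mul_scalar_mx -scalemxAr scalerA mulVf // scale1r mul_delta_mx.
  by rewrite phiM -mulmxA -T_mul Tx0 mulmx0.
apply/matrixP => a k.
(* Both columns equal phi (A^{ij} e_k r) v, since B^{ij} is the image of the word with no inner
   site. *)
have: col k (B i j *m T j) = col k (T i *m A i j).
  by rewrite !colE -!mulmxA !T_mul -mulmxA (phiM i j) mulmxA (phi_word i j [::]).
by move=> /colP/(_ a); rewrite !mxE.
Qed.

End Intertwiner.

Theorem theorem1 (R : realType) (d : nat) (hd : (1 <= d)%N)
    (chiA chiB : 'I_d -> nat) (A : simps R chiA) (B : simps R chiB)
    (normalA : simps_normal A) (normalB : simps_normal B)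
    (same_state : forall N : nat, (1 <= N)%N ->
       simps_state A N = simps_state B N) :
  exists (chiE : forall i : 'I_d, chiB i = chiA i)
         (V : forall i : 'I_d, 'M[R[i]]_(chiA i)),
    (forall i : 'I_d, V i \in unitmx) /\
    (forall i j : 'I_d,
       A i j = V i *m castmx (chiE i, chiE j) (B i j) *m invmx (V j)).
Proof.
have [T [rankT BT]] := intertwiner_exists normalA normalB same_state.
have same_state' N : (1 <= N)%N -> simps_state B N = simps_state A N.
  by move=> /same_state.
have [S [rankS _]] := intertwiner_exists normalB normalA same_state'.
(* Full column rank of [T i] and of [S i] gives one inequality each. *)
have chiE i : chiB i = chiA i.
  have := rank_leq_row (T i); have := rank_leq_row (S i).
  by rewrite rankT rankS => SA TB; apply/eqP; rewrite eqn_leq SA.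
pose W i := castmx (chiE i, erefl (chiA i)) (T i).
have unitW i : W i \in unitmx by apply: castmx_unit.
(* B T = T A solves to A = T^-1 B T, so V is the inverse of the intertwiner. *)
exists chiE, (fun i => invmx (W i)); split=> [i|i j]; first by rewrite unitmx_inv.
by rewrite invmxK -mulmxA castmx_mull BT -castmx_mulr mulKmx.
Qed.
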